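(* Let $(\Sigma,\mathscr R)$ be a Dedukti theory such that $\hookrightarrow_{\beta\mathscr R}$ is confluent and $\mathscr R$ is well-formed. If $\Sigma;\Gamma\vdash M:A$, then exactly one of the following holds: (1) $M$ is a kind and $A=\mathtt{KIND}$; (2) $M$ is a type family and $A$ is a kind; (3) $M$ is an object and $A$ is a type family.
   Context: Dedukti terms: $x\mid c[M_1,\dots,M_{n_c}]\mid\mathtt{TYPE}\mid\mathtt{KIND}\mid MN\mid\lambda x:A.M\mid\Pi x:A.B$, constants with fixed arity. Signature: declarations $c[\Delta]:A$; rules $c[\vec l]\hookrightarrow r$; $\hookrightarrow_{\beta\mathscr R}$ is $\beta$ plus the context/substitution closure of $\mathscr R$, $\equiv$ its equivalence. Typing rules ($s\in\{\mathtt{TYPE},\mathtt{KIND}\}$): Empty; Decl ($\Sigma;\Gamma\vdash A:\mathtt{TYPE}$, $x\notin\Gamma$ give $\Sigma;\Gamma,x:A$ well-formed); Cons ($c[\Delta]:A\in\Sigma$, $\Sigma;\Delta\vdash A:s$, $\Sigma;\Gamma\vdash\vec M:\Delta$ give $\Sigma;\Gamma\vdash c[\vec M]:A\{\vec M\}$, where $\Sigma;\Gamma\vdash\vec M:\Delta$ for $\Delta=x_1:A_1,\dots,x_n:A_n$ means $\Sigma;\Gamma\vdash M_i:A_i\{M_1/x_1\}\cdots\{M_{i-1}/x_{i-1}\}$); Sort ($\mathtt{TYPE}:\mathtt{KIND}$ in well-formed contexts); Var; Conv ($M:A$, $B:s$, $A\equiv B$ give $M:B$); Prod ($A:\mathtt{TYPE}$,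 $x:A\vdash B:s$ give $\Pi x:A.B:s$); App ($M:\Pi x:A.B$, $N:A$ give $MN:B\{N/x\}$); Abs ($A:\mathtt{TYPE}$, $x:A\vdash B:s$, $x:A\vdash M:B$ give $\lambda x:A.M:\Pi x:A.B$). A constant $c$ is type-level (written $\alpha$) if $c[\Delta]:A\in\Sigma$ with $A=\Pi\vec x:\vec B.\mathtt{TYPE}$, otherwise object-level (written $a$); a rule is type-level if its head constant is. $\mathscr R$ is well-formed if the right-hand side of every type-level rule is in the grammar $R::=\alpha[\vec M]\mid R\,N\mid\lambda x:B.R\mid\Pi x:R.R$ ($\vec M,N,B$ arbitrary). Kinds, type families and objects: $K::=\mathtt{TYPE}\mid\Pi x:T.K$; $T::=\alpha[\vec O]\mid T\,O\mid\lambda x:T.T\mid\Pi x:T.T$; $O::=x\mid a[\vec O]\mid O\,O\mid\lambda x:T.O$.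
   Formalization: The judgement that M-vector has type Δ also requires Γ to be well-formed when Δ is empty (otherwise d[]:TYPE, c[x:KIND]:d[] gives ⊢ c[TYPE]:d[], a counterexample); Σ is a finite list declaring each constant at most once. *)

(* Defs.v *)
From Stdlib Require Import List Relations.
From Stdlib Require Vector.
Import ListNotations.

Set Implicit Arguments.
Unset Strict Implicit.

Record constants := Constants { const :> Type; arity : const -> nat }.

(* Terms up to alpha-equivalence, with de Bruijn indices: [Lam A M] and
   [Pi A B] bind the index 0 in [M] and [B]. *)
Inductive term (C : constants) : Type :=
  | Var (x : nat)
  | Cst (c : C) (Ms : Vector.t (term C) (arity c))
  | TYPE
  | KIND
  | App (M N : term C)
  | Lam (A M : term C)
  | Pi (A B : term C).

Arguments Var {C} x.
Arguments TYPE {C}.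
Arguments KIND {C}.

Inductive is_sort (C : constants) : term C -> Prop :=
  | is_sort_TYPE : is_sort TYPE
  | is_sort_KIND : is_sort KIND.

Definition scons (T : Type) (a : T) (f : nat -> T) (x : nat) : T :=
  match x with 0 => a | S y => f y end.

Definition up_ren (f : nat -> nat) : nat -> nat := scons 0 (fun x => S (f x)).

Fixpoint rename (C : constants) (f : nat -> nat) (M : term C) : term C :=
  match M with
  | Var x => Var (f x)
  | Cst Ms => Cst (Vector.map (rename f) Ms)
  | TYPE => TYPE
  | KIND => KIND
  | App M N => App (rename f M) (rename f N)
  | Lam A M => Lam (rename f A) (rename (up_ren f) M)
  | Pi A B => Pi (rename f A) (rename (up_ren f) B)
  end.

Definition up (C : constants) (s : nat -> term C) : nat -> term C :=
  scons (Var 0) (fun x => rename S (s x)).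

Fixpoint subst (C : constants) (s : nat -> term C) (M : term C) : term C :=
  match M with
  | Var x => s x
  | Cst Ms => Cst (Vector.map (subst s) Ms)
  | TYPE => TYPE
  | KIND => KIND
  | App M N => App (subst s M) (subst s N)
  | Lam A M => Lam (subst s A) (subst (up s) M)
  | Pi A B => Pi (subst s A) (subst (up s) B)
  end.

Definition subst1 (C : constants) (N M : term C) : term C :=
  subst (scons N Var) M.

(* [subst_list [M_n; ...; M_1] A] is A{M_1/x_1}...{M_n/x_n}, for A living in
   the context x_1, ..., x_n, whose innermost variable x_n has index 0. *)
Definition subst_list (C : constants) (Ms : list (term C)) (A : term C)
    : term C :=
  subst (fold_right (@scons _) Var Ms) A.

(* The most recent declaration comes first: x_1 : A_1, ..., x_n : A_n is
   [A_n; ...; A_1], and each A_i lives in the tail that follows it. *)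
Definition context (C : constants) : Type := list (term C).

(* The declaration c[Delta] : A. *)
Record declaration (C : constants) := Declaration {
  decl_const : C;
  decl_ctx : context C;
  decl_type : term C;
  decl_arity : length decl_ctx = arity decl_const
}.

Record signature (C : constants) := Signature {
  decls : list (declaration C);
  decls_unique : NoDup (List.map (@decl_const C) decls)
}.

(* The rule c[l_1, ..., l_n] --> r. *)
Record rule (C : constants) := Rule {
  rule_head : C;
  rule_args : Vector.t (term C) (arity rule_head);
  rule_rhs : term C
}.

Record theory (C : constants) := Theory {
  theory_sig : signature C;
  theory_rules : rule C -> Prop
}.

Inductive step (C : constants) (T : theory C) : term C -> term C -> Prop :=
  | step_beta A M N : step T (App (Lam A M) N) (subst1 N M)
  | step_rule (r : rule C) (s : nat -> term C) :
      theory_rules T r ->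
      step T (subst s (Cst (rule_args r))) (subst s (rule_rhs r))
  | step_Cst (c : C) (Ms : Vector.t (term C) (arity c))
        (i : Fin.t (arity c)) N :
      step T (Vector.nth Ms i) N -> step T (Cst Ms) (Cst (Vector.replace Ms i N))
  | step_App_l M M' N : step T M M' -> step T (App M N) (App M' N)
  | step_App_r M N N' : step T N N' -> step T (App M N) (App M N')
  | step_Lam_l A A' M : step T A A' -> step T (Lam A M) (Lam A' M)
  | step_Lam_r A M M' : step T M M' -> step T (Lam A M) (Lam A M')
  | step_Pi_l A A' B : step T A A' -> step T (Pi A B) (Pi A' B)
  | step_Pi_r A B B' : step T B B' -> step T (Pi A B) (Pi A B').

Definition conv (C : constants) (T : theory C) : term C -> term C -> Prop :=
  clos_refl_sym_trans (term C) (step T).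

Definition confluent (X : Type) (R : X -> X -> Prop) : Prop :=
  forall x y z, clos_refl_trans X R x y -> clos_refl_trans X R x z ->
  exists t, clos_refl_trans X R y t /\ clos_refl_trans X R z t.

Inductive well_formed_ctx (C : constants) (T : theory C) : context C -> Prop :=
  | wf_Empty : well_formed_ctx T []
  | wf_Decl Gamma A :
      typing T Gamma A TYPE -> well_formed_ctx T (A :: Gamma)
with typing (C : constants) (T : theory C)
    : context C -> term C -> term C -> Prop :=
  | ty_Cons Gamma (d : declaration C)
        (Ms : Vector.t (term C) (arity (decl_const d))) s :
      In d (decls (theory_sig T)) ->
      is_sort s -> typing T (decl_ctx d) (decl_type d) s ->
      typed_args T Gamma (rev (Vector.to_list Ms)) (decl_ctx d) ->
      typing T Gamma (Cst Ms)
        (subst_list (rev (Vector.to_list Ms)) (decl_type d))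
  | ty_Sort Gamma : well_formed_ctx T Gamma -> typing T Gamma TYPE KIND
  | ty_Var Gamma x A :
      well_formed_ctx T Gamma -> nth_error Gamma x = Some A ->
      typing T Gamma (Var x) (rename (Nat.add (S x)) A)
  | ty_Conv Gamma M A B s :
      typing T Gamma M A -> is_sort s -> typing T Gamma B s -> conv T A B ->
      typing T Gamma M B
  | ty_Prod Gamma A B s :
      typing T Gamma A TYPE -> is_sort s -> typing T (A :: Gamma) B s ->
      typing T Gamma (Pi A B) s
  | ty_App Gamma M N A B :
      typing T Gamma M (Pi A B) -> typing T Gamma N A ->
      typing T Gamma (App M N) (subst1 N B)
  | ty_Abs Gamma A B M s :
      typing T Gamma A TYPE -> is_sort s -> typing T (A :: Gamma) B s ->
      typing T (A :: Gamma) M B ->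
      typing T Gamma (Lam A M) (Pi A B)
(* [typed_args T Gamma [M_n; ...; M_1] Delta] is Gamma |- M_1, ..., M_n : Delta.
   For the empty Delta it asks Gamma to be well-formed; for a nonempty one this
   already follows from the typing of the M_i. *)
with typed_args (C : constants) (T : theory C)
    : context C -> list (term C) -> context C -> Prop :=
  | args_nil Gamma : well_formed_ctx T Gamma -> typed_args T Gamma [] []
  | args_cons Gamma Ms Delta M A :
      typed_args T Gamma Ms Delta -> typing T Gamma M (subst_list Ms A) ->
      typed_args T Gamma (M :: Ms) (A :: Delta).

Inductive ends_in_TYPE (C : constants) : term C -> Prop :=
  | ends_TYPE : ends_in_TYPE TYPE
  | ends_Pi A B : ends_in_TYPE B -> ends_in_TYPE (Pi A B).

Definition type_level (C : constants) (S : signature C) (c : C) : Prop :=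
  exists d, In d (decls S) /\ decl_const d = c /\ ends_in_TYPE (decl_type d).

Definition object_level (C : constants) (S : signature C) (c : C) : Prop :=
  ~ type_level S c.

Inductive type_rhs (C : constants) (S : signature C) : term C -> Prop :=
  | rhs_Cst (c : C) (Ms : Vector.t (term C) (arity c)) :
      type_level S c -> type_rhs S (Cst Ms)
  | rhs_App R N : type_rhs S R -> type_rhs S (App R N)
  | rhs_Lam B R : type_rhs S R -> type_rhs S (Lam B R)
  | rhs_Pi R1 R2 : type_rhs S R1 -> type_rhs S R2 -> type_rhs S (Pi R1 R2).

Definition well_formed_rules (C : constants) (T : theory C) : Prop :=
  forall r, theory_rules T r -> type_level (theory_sig T) (rule_head r) ->
  type_rhs (theory_sig T) (rule_rhs r).

Inductive is_type_family (C : constants) (S : signature C) : term C -> Prop :=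
  | fam_Cst (c : C) (Ms : Vector.t (term C) (arity c)) :
      type_level S c -> (forall i, is_object S (Vector.nth Ms i)) ->
      is_type_family S (Cst Ms)
  | fam_App A N :
      is_type_family S A -> is_object S N -> is_type_family S (App A N)
  | fam_Lam A B :
      is_type_family S A -> is_type_family S B -> is_type_family S (Lam A B)
  | fam_Pi A B :
      is_type_family S A -> is_type_family S B -> is_type_family S (Pi A B)
with is_object (C : constants) (S : signature C) : term C -> Prop :=
  | obj_Var x : is_object S (Var x)
  | obj_Cst (c : C) (Ms : Vector.t (term C) (arity c)) :
      object_level S c -> (forall i, is_object S (Vector.nth Ms i)) ->
      is_object S (Cst Ms)
  | obj_App M N : is_object S M -> is_object S N -> is_object S (App M N)
  | obj_Lam A M : is_type_family S A -> is_object S M -> is_object S (Lam A M).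

Inductive is_kind (C : constants) (S : signature C) : term C -> Prop :=
  | kind_TYPE : is_kind S TYPE
  | kind_Pi A K : is_type_family S A -> is_kind S K -> is_kind S (Pi A K).

Definition exactly_one (P Q R : Prop) : Prop :=
  (P /\ ~ Q /\ ~ R) \/ (~ P /\ Q /\ ~ R) \/ (~ P /\ ~ Q /\ R).

(* Main.v *)
From Stdlib Require Import List Relations.
From Stdlib Require Vector.
Require Import Defs.
Import ListNotations.

(** Reduction does not preserve type families: the right-hand side of an
    object-level rule is arbitrary, so [TYPE] may appear at an object position.
    What it does preserve is the spine.  A type family lies in the grammar [R]
    of type-level right-hand sides, a kind is a product ending in [TYPE], and
    both of these coarser classes are stable under reduction; they are disjoint
    and neither contains [KIND].  By confluence no term of one class is
    convertible to a term of another, so the conversion rule keeps the level of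
    the type, and the classification follows by induction on derivations. *)

Set Implicit Arguments.
Unset Strict Implicit.

Scheme well_formed_ctx_mut := Minimality for well_formed_ctx Sort Prop
  with typing_mut := Minimality for typing Sort Prop
  with typed_args_mut := Minimality for typed_args Sort Prop.

Scheme is_type_family_mut := Minimality for is_type_family Sort Prop
  with is_object_mut := Minimality for is_object Sort Prop.
Combined Scheme is_type_family_object_ind
  from is_type_family_mut, is_object_mut.

(** * Stability under reduction *)

Lemma type_rhs_subst (C : constants) (S : signature C) (R : term C) :
  type_rhs S R -> forall s, type_rhs S (subst s R).
Proof.
  induction 1; intros s; simpl; constructor; auto.
Qed.

(** A rule applied at the root has a type-level head, so well-formedness puts its right-hand side in
    the grammar; a beta step keeps the body of an abstraction of the grammar. Constant arguments,
    applied arguments and abstraction domains are arbitrary, so steps inside them are harmless. *)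
Lemma type_rhs_step (C : constants) (T : theory C) (M N : term C) :
  well_formed_rules T -> step T M N ->
  type_rhs (theory_sig T) M -> type_rhs (theory_sig T) N.
Proof.
  intros Hwf Hstep; induction Hstep; intros HM;
    inversion HM; subst; try (constructor; now auto).
  - match goal with H : type_rhs _ (Lam _ _) |- _ => inversion H; subst end.
    now apply type_rhs_subst.
  - apply type_rhs_subst; now apply Hwf.
Qed.

Lemma ends_in_TYPE_step (C : constants) (T : theory C) (M N : term C) :
  step T M N -> ends_in_TYPE M -> ends_in_TYPE N.
Proof.
  induction 1; intros HM; inversion HM; subst; constructor; auto.
Qed.

Lemma KIND_step (C : constants) (T : theory C) (M N : term C) :
  step T M N -> M <> KIND.
Proof.
  destruct 1; simpl; discriminate.
Qed.

Lemma clos_refl_trans_stable (X : Type) (R : X -> X -> Prop) (P : X -> Prop) :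
  (forall x y, R x y -> P x -> P y) ->
  forall x y, clos_refl_trans X R x y -> P x -> P y.
Proof.
  intros HP x y Hxy; induction Hxy; eauto.
Qed.

Lemma confluent_common_reduct (X : Type) (R : X -> X -> Prop) :
  confluent R -> forall x y, clos_refl_sym_trans X R x y ->
  exists z, clos_refl_trans X R x z /\ clos_refl_trans X R y z.
Proof.
  intros Hconf x y Hxy.
  induction Hxy as [x y H | x | x y _ [z [Hx Hy]]
                   | x y z _ [u [Hxu Hyu]] _ [v [Hyv Hzv]]].
  - exists y; split; [now apply rt_step | apply rt_refl].
  - exists x; split; apply rt_refl.
  - now exists z.
  - destruct (Hconf y u v Hyu Hyv) as [w [Huw Hvw]].
    exists w; split; eapply rt_trans; eauto.
Qed.

(** A common reduct, which confluence provides, would lie in both classes. *)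
Lemma stable_disjoint_not_convertible (X : Type) (R : X -> X -> Prop)
    (P Q : X -> Prop) :
  confluent R ->
  (forall x y, R x y -> P x -> P y) -> (forall x y, R x y -> Q x -> Q y) ->
  (forall x, P x -> Q x -> False) ->
  forall x y, clos_refl_sym_trans X R x y -> P x -> Q y -> False.
Proof.
  intros Hconf HP HQ Hdisj x y Hxy Px Qy.
  destruct (confluent_common_reduct Hconf Hxy) as [z [Hxz Hyz]].
  exact (Hdisj z (clos_refl_trans_stable HP Hxz Px)
           (clos_refl_trans_stable HQ Hyz Qy)).
Qed.

(** * The three syntactic classes *)

Lemma type_rhs_not_ends_in_TYPE (C : constants) (S : signature C)
    (M : term C) :
  type_rhs S M -> ends_in_TYPE M -> False.
Proof.
  induction 1; intros HM; inversion HM; auto.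
Qed.

Lemma is_type_family_type_rhs (C : constants) (S : signature C) (M : term C) :
  is_type_family S M -> type_rhs S M.
Proof.
  (* Nothing is needed about objects: they occur only where the grammar allows any term. *)
  intros HM; apply is_type_family_mut with (S := S) (P0 := fun _ => True);
    auto; constructor; auto.
Qed.

Lemma is_kind_ends_in_TYPE (C : constants) (S : signature C) (M : term C) :
  is_kind S M -> ends_in_TYPE M.
Proof.
  induction 1; constructor; auto.
Qed.

Lemma is_type_family_not_is_kind (C : constants) (S : signature C)
    (M : term C) :
  is_type_family S M -> is_kind S M -> False.
Proof.
  intros HF HK; eapply type_rhs_not_ends_in_TYPE;
    eauto using is_type_family_type_rhs, is_kind_ends_in_TYPE.
Qed.

(** * Substitution of objects for variables *)

Lemma is_type_family_object_rename (C : constants) (S : signature C) :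
  (forall A, is_type_family S A -> forall f, is_type_family S (rename f A)) /\
  (forall M, is_object S M -> forall f, is_object S (rename f M)).
Proof.
  apply is_type_family_object_ind; simpl; intros; constructor; auto;
    intros i; rewrite (Vector.nth_map _ _ _ _ eq_refl); auto.
Qed.

Lemma is_object_up (C : constants) (S : signature C) (s : nat -> term C) :
  (forall x, is_object S (s x)) -> forall x, is_object S (up s x).
Proof.
  intros Hs [|x]; simpl; [constructor | now apply is_type_family_object_rename].
Qed.

Lemma is_type_family_object_subst (C : constants) (S : signature C) :
  (forall A, is_type_family S A -> forall s, (forall x, is_object S (s x)) ->
    is_type_family S (subst s A)) /\
  (forall M, is_object S M -> forall s, (forall x, is_object S (s x)) ->
    is_object S (subst s M)).
Proof.
  apply is_type_family_object_ind; simpl; intros; auto; constructor;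
    auto using is_object_up;
    intros i; rewrite (Vector.nth_map _ _ _ _ eq_refl); auto.
Qed.

Lemma is_kind_subst (C : constants) (S : signature C) (K : term C) :
  is_kind S K -> forall s, (forall x, is_object S (s x)) ->
  is_kind S (subst s K).
Proof.
  induction 1; intros s Hs; simpl; constructor; auto using is_object_up.
  now apply is_type_family_object_subst.
Qed.

Lemma is_object_scons_list (C : constants) (S : signature C)
    (Ms : list (term C)) :
  Forall (is_object S) Ms ->
  forall x, is_object S (fold_right (@scons _) Var Ms x).
Proof.
  induction 1 as [|M Ms HM _ IH]; intros x; [constructor|].
  destruct x; simpl; auto.
Qed.

Lemma is_object_scons (C : constants) (S : signature C) (N : term C) :
  is_object S N -> forall x, is_object S (scons N Var x).
Proof.
  intros HN [|x]; simpl; [assumption | constructor].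
Qed.

(** * Argument vectors and uniqueness of declarations *)

Lemma In_nth_to_list (X : Type) (n : nat) (v : Vector.t X n) (i : Fin.t n) :
  In (Vector.nth v i) (Vector.to_list v).
Proof.
  induction i as [n | n i IH]; rewrite (Vector.eta v); simpl;
    [now left | right; apply IH].
Qed.

Lemma NoDup_map_inj_in (X Y : Type) (f : X -> Y) (l : list X) :
  NoDup (map f l) -> forall x y, In x l -> In y l -> f x = f y -> x = y.
Proof.
  induction l as [|a l IH]; simpl; intros Hl x y Hx Hy Hxy; [easy|].
  inversion Hl as [|? ? Ha Hl']; subst.
  destruct Hx as [-> | Hx], Hy as [-> | Hy]; auto; destruct Ha.
  - rewrite Hxy; now apply in_map.
  - rewrite <- Hxy; now apply in_map.
Qed.

Lemma decl_const_inj (C : constants) (S : signature C)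
    (d d' : declaration C) :
  In d (decls S) -> In d' (decls S) -> decl_const d = decl_const d' -> d = d'.
Proof.
  intros Hd Hd' Heq.
  exact (NoDup_map_inj_in (decls_unique S) Hd Hd' Heq).
Qed.

(** * Classification *)

(** The three cases without their exclusiveness, which is recovered at the end from the type
    alone. *)
Definition classified (C : constants) (S : signature C) (M A : term C) : Prop :=
  (is_kind S M /\ A = KIND) \/
  (is_type_family S M /\ is_kind S A) \/
  (is_object S M /\ is_type_family S A).

Lemma classified_TYPE (C : constants) (S : signature C) (A : term C) :
  classified S A TYPE -> is_type_family S A.
Proof.
  intros [[_ H] | [[H _] | [_ H]]]; [discriminate | assumption | inversion H].
Qed.

(** [KIND] is neither a kind nor a type family, and [TYPE] is not a type family, so the sort
    determines the case. *)
Lemma classified_sort (C : constants) (S : signature C) (A s : term C) :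
  is_sort s -> classified S A s ->
  (is_kind S A /\ s = KIND) \/ (is_type_family S A /\ s = TYPE).
Proof.
  intros Hs [[HA ->] | [[HA Hk] | [_ Hf]]]; [now left | right | ];
    destruct Hs; auto.
  - inversion Hk.
  - inversion Hf.
  - inversion Hf.
Qed.

Lemma classified_object (C : constants) (S : signature C) (M A : term C) :
  is_type_family S A -> classified S M A -> is_object S M.
Proof.
  intros HA [[_ ->] | [[_ HK] | [HM _]]]; [inversion HA | | assumption].
  now destruct (is_type_family_not_is_kind HA HK).
Qed.

(** * Conversion and typing *)

Section Typing.

Variables (C : constants) (T : theory C).
Hypotheses (Hconf : confluent (step T)) (Hwf : well_formed_rules T).

Local Notation Sigma := (theory_sig T).

Lemma conv_kind_type_family (A B : term C) :
  conv T A B -> is_kind Sigma A -> is_type_family Sigma B -> False.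
Proof.
  intros HAB HA HB.
  apply (stable_disjoint_not_convertible (P := @ends_in_TYPE C)
           (Q := type_rhs Sigma) Hconf) with (x := A) (y := B);
    eauto using ends_in_TYPE_step, type_rhs_step, type_rhs_not_ends_in_TYPE,
      is_kind_ends_in_TYPE, is_type_family_type_rhs.
Qed.

Lemma conv_KIND (B : term C) :
  conv T KIND B -> is_kind Sigma B \/ is_type_family Sigma B -> False.
Proof.
  intros HB HC.
  (* The class consisting of [KIND] alone is stable vacuously, since [KIND] has no reduct. *)
  assert (Hred : forall x y, step T x y -> x = KIND -> y = KIND)
    by (intros x y Hxy Hx; now destruct (KIND_step Hxy)).
  destruct HC as [HC | HC].
  - apply (stable_disjoint_not_convertible (P := fun M => M = KIND)
             (Q := @ends_in_TYPE C) Hconf) with (x := KIND) (y := B);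
      eauto using ends_in_TYPE_step, is_kind_ends_in_TYPE.
    intros x -> Hx; inversion Hx.
  - apply (stable_disjoint_not_convertible (P := fun M => M = KIND)
             (Q := type_rhs Sigma) Hconf) with (x := KIND) (y := B);
      eauto using type_rhs_step, is_type_family_type_rhs.
    intros x -> Hx; inversion Hx.
Qed.

(** Having a sort as type makes [B] a kind or a type family; convertibility with [A] then rules out
    every change of level. *)
Lemma classified_conv (M A B s : term C) :
  classified Sigma M A -> is_sort s -> classified Sigma B s -> conv T A B ->
  classified Sigma M B.
Proof.
  intros HM Hs HB HAB.
  destruct (classified_sort Hs HB) as [[HB' _] | [HB' _]];
    destruct HM as [[HM ->] | [[HM HA] | [HM HA]]].
  - destruct (conv_KIND HAB); auto.
  - right; left; auto.
  - destruct (@conv_kind_type_family B A); auto.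
    now apply rst_sym.
  - destruct (conv_KIND HAB); auto.
  - destruct (conv_kind_type_family HAB HA HB').
  - right; right; auto.
Qed.

(** The level of the constant is read off its declared type: a kind ends in [TYPE], while a type
    family does not. *)
Lemma classified_Cst (d : declaration C)
    (Ms : Vector.t (term C) (arity (decl_const d))) (s : term C) :
  In d (decls Sigma) -> is_sort s -> classified Sigma (decl_type d) s ->
  Forall (is_object Sigma) (rev (Vector.to_list Ms)) ->
  classified Sigma (Cst Ms)
    (subst_list (rev (Vector.to_list Ms)) (decl_type d)).
Proof.
  intros Hd Hs HA HMs.
  assert (Hargs : forall i, is_object Sigma (Vector.nth Ms i)).
  { intros i; rewrite Forall_forall in HMs.
    apply HMs; rewrite <- in_rev; apply In_nth_to_list. }
  assert (Hsub := is_object_scons_list HMs).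
  destruct (classified_sort Hs HA) as [[HK _] | [HF _]]; right.
  - left; split; [constructor; auto | now apply is_kind_subst].
    exists d; eauto using is_kind_ends_in_TYPE.
  - right; split; [constructor; auto | now apply is_type_family_object_subst].
    (* A type-level witness might be another declaration of the same constant; uniqueness identifies
       it with [d]. *)
    intros [d' [Hd' [Heq Hend]]].
    rewrite (decl_const_inj Hd' Hd Heq) in Hend.
    exact (type_rhs_not_ends_in_TYPE (is_type_family_type_rhs HF) Hend).
Qed.

Lemma typing_classified (Gamma : context C) (M A : term C) :
  typing T Gamma M A -> classified Sigma M A.
Proof.
  intros HM.
  (* The variable rule needs the context to consist of type families, so this is carried through the
     induction. *)
  enough (H : Forall (is_type_family Sigma) Gamma /\ classified Sigma M A)
    by apply H.
  revert Gamma M A HM.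
  (* The typing of arguments does not say that [Delta] is well-formed, hence the implication; for a
     constant, the typing of its declared type in [Delta] discharges it. *)
  apply (@typing_mut C T
    (fun Gamma => Forall (is_type_family Sigma) Gamma)
    (fun Gamma M A =>
       Forall (is_type_family Sigma) Gamma /\ classified Sigma M A)
    (fun Gamma Ms Delta => Forall (is_type_family Sigma) Gamma /\
       (Forall (is_type_family Sigma) Delta -> Forall (is_object Sigma) Ms))).
  - constructor.
  - intros Gamma A _ [HG HA]; constructor; auto using classified_TYPE.
  - intros Gamma d Ms s Hd Hs _ [HDelta HA] _ [HG HMs].
    split; [assumption | eapply classified_Cst; eauto].
  - intros Gamma _ HG; split; [assumption | left; split; constructor].
  - intros Gamma x A _ HG Hx; split; [assumption | right; right; split].
    + constructor.
    + apply is_type_family_object_rename.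
      rewrite Forall_forall in HG; eauto using nth_error_In.
  - intros Gamma M A B s _ [HG HM] Hs _ [_ HB] HAB.
    split; [assumption | eapply classified_conv; eauto].
  - intros Gamma A B s _ [HG HA] Hs _ [_ HB].
    apply classified_TYPE in HA; split; [assumption|].
    destruct (classified_sort Hs HB) as [[HK ->] | [HF ->]].
    + left; split; [now constructor | reflexivity].
    + right; left; split; now constructor.
  - intros Gamma M N A B _ [HG HM] _ [_ HN]; split; [assumption|].
    destruct HM as [[_ HM] | [[HM HP] | [HM HP]]];
      [discriminate | right; left | right; right];
      (* Whether the product is a kind or a type family, its domain [A] is a type family, which
         makes [N] an object, and its codomain is in the same class as the product. *)
      inversion HP; subst;
      assert (HN' : is_object Sigma N)
        by (apply (@classified_object C Sigma N A); assumption);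
      (split; [now constructor|]).
    + apply is_kind_subst; auto using is_object_scons.
    + apply is_type_family_object_subst; auto using is_object_scons.
  - intros Gamma A B M s _ [HG HA] Hs _ [_ HB] _ [_ HM].
    apply classified_TYPE in HA; split; [assumption | right].
    destruct HM as [[HM ->] | [[HM HK] | [HM HF]]].
    (* The body cannot have type [KIND], because the rule asks that type to have a sort itself. *)
    + destruct (classified_sort Hs HB) as [[H _] | [H _]]; inversion H.
    + left; split; now constructor.
    + right; split; now constructor.
  - intros Gamma _ HG; split; [assumption | constructor].
  - intros Gamma Ms Delta M A _ [HG HMs] _ [_ HM]; split; [assumption|].
    intros HDelta; inversion HDelta as [|? ? HA HD]; subst.
    specialize (HMs HD); constructor; [|assumption].
    refine (classified_object _ HM).
    apply is_type_family_object_subst; auto using is_object_scons_list.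
Qed.

End Typing.

Theorem mainTheorem5 (C : constants) (T : theory C)
    (Hconf : confluent (step T)) (Hwf : well_formed_rules T)
    (Gamma : context C) (M A : term C) (HM : typing T Gamma M A) :
  exactly_one
    (is_kind (theory_sig T) M /\ A = KIND)
    (is_type_family (theory_sig T) M /\ is_kind (theory_sig T) A)
    (is_object (theory_sig T) M /\ is_type_family (theory_sig T) A).
Proof.
  (* The cases exclude each other through [A], which is at most one of [KIND], a kind and a type
     family. *)
  assert (HKF : is_type_family (theory_sig T) A ->
      is_kind (theory_sig T) A -> False)
    by apply is_type_family_not_is_kind.
  assert (HK : is_kind (theory_sig T) A -> ~ A = KIND)
    by (intros H ->; inversion H).
  assert (HF : is_type_family (theory_sig T) A -> ~ A = KIND)
    by (intros H ->; inversion H).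
  unfold exactly_one.
  destruct (typing_classified Hconf Hwf HM) as [H | [H | H]]; tauto.
Qed.
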